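(* (Cross law) Let $\mathbb{F}$ be a field of characteristic not $2$ and let $B$ be an invertible symmetric $3\times 3$ matrix over $\mathbb{F}$. Let $\overline{v_1v_2v_3}$ be a vector triangle in $\mathbb{V}^3=\mathbb{F}^3$ whose $B$-spreads are defined (i.e. $v_1,v_2,v_3$ are all non-null), with $B$-quadrances $Q_1,Q_2,Q_3$ and corresponding $B$-spreads $s_1,s_2,s_3$. Then $$(Q_2+Q_3-Q_1)^2=4Q_2Q_3(1-s_1),$$ $$(Q_1+Q_3-Q_2)^2=4Q_1Q_3(1-s_2),$$ $$(Q_1+Q_2-Q_3)^2=4Q_1Q_2(1-s_3).$$
   Context: $\mathbb{V}^3$ is the space of row vectors over $\mathbb{F}$. The $B$-scalar product is $v\cdot_B w=vBw^T$, the $B$-quadrance is $Q_B(v)=v\cdot_B v$, and $v$ is null if $Q_B(v)=0$. A vector triangle $\overline{v_1v_2v_3}$ is an unordered collection of three vectors with $v_1+v_2+v_3=\mathbf{0}$. Its $B$-quadrances are $Q_i=Q_B(v_i)$. The $B$-spread of non-null vectors $v,w$ is $s_B(v,w)=1-\dfrac{(v\cdot_B w)^2}{Q_B(v)Q_B(w)}$ (undefined if $v$ or $w$ is null), and the $B$-spreads of the triangle are $s_1=s_B(v_2,v_3)$, $s_2=s_B(v_1,v_3)$, $s_3=s_B(v_1,v_2)$. *)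

(* Defs.v *)
From mathcomp Require Import all_boot all_algebra.

Set Implicit Arguments.
Unset Strict Implicit.
Unset Printing Implicit Defensive.

Import GRing.Theory.
Local Open Scope ring_scope.

(* The product is a 1 x 1 matrix; its single entry is the scalar. *)
Definition bdot (F : fieldType) (B : 'M[F]_3) (v w : 'rV[F]_3) : F :=
  (v *m B *m w^T) 0 0.

Definition quadrance (F : fieldType) (B : 'M[F]_3) (v : 'rV[F]_3) : F :=
  bdot B v v.

Definition null_vector (F : fieldType) (B : 'M[F]_3) (v : 'rV[F]_3) : Prop :=
  quadrance B v = 0.

(* The spread is only meaningful when v and w are both non-null; otherwise
   the value is an artefact of the convention 0^-1 = 0. *)
Definition spread (F : fieldType) (B : 'M[F]_3) (v w : 'rV[F]_3) : F :=
  1 - bdot B v w ^+ 2 / (quadrance B v * quadrance B w).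

(* Every labelling of an unordered triangle satisfies this symmetric condition. *)
Definition vector_triangle (F : fieldType) (v1 v2 v3 : 'rV[F]_3) : Prop :=
  v1 + v2 + v3 = 0.

(* Main.v *)
Require Import Defs.
From mathcomp Require Import all_boot all_algebra.
From mathcomp Require Import ring.

Set Implicit Arguments.
Unset Strict Implicit.
Unset Printing Implicit Defensive.

Import GRing.Theory.
Local Open Scope ring_scope.

(** The cross law is the law of cosines, squared. In a vector triangle each
    side is minus the sum of the other two, so, the form being symmetric,
    expanding its quadrance gives [Q u = Q v + Q w + 2 (v . w)]. Hence
    [Q v + Q w - Q u] is [- 2 (v . w)], and squaring removes the sign. On the
    other side [1 - s] is [(v . w) ^ 2 / (Q v * Q w)], whose denominator cancels
    because [v] and [w] are non-null. The three equations are this one fact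
    ([cross_law]), applied to each side in turn. *)

Lemma bdotDl (F : fieldType) (B : 'M[F]_3) (u v w : 'rV[F]_3) :
  bdot B (u + v) w = bdot B u w + bdot B v w.
Proof. by rewrite /bdot !mulmxDl mxE. Qed.

Lemma bdotDr (F : fieldType) (B : 'M[F]_3) (u v w : 'rV[F]_3) :
  bdot B u (v + w) = bdot B u v + bdot B u w.
Proof. by rewrite /bdot linearD mulmxDr mxE. Qed.

(** A 1 x 1 matrix is its own transpose, and transposing [v B w^T] exchanges
    [v] and [w] when [B] is symmetric. *)
Lemma bdotC (F : fieldType) (B : 'M[F]_3) (v w : 'rV[F]_3) :
  B^T = B -> bdot B v w = bdot B w v.
Proof.
move=> B_sym; rewrite /bdot -[in LHS](trmxK (v *m B *m w^T)) mxE.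
by rewrite !trmx_mul trmxK B_sym mulmxA.
Qed.

Lemma quadranceN (F : fieldType) (B : 'M[F]_3) (v : 'rV[F]_3) :
  quadrance B (- v) = quadrance B v.
Proof. by rewrite /quadrance /bdot linearN mulNmx mulmxN mulNmx opprK. Qed.

Lemma quadranceD (F : fieldType) (B : 'M[F]_3) (v w : 'rV[F]_3) :
  B^T = B ->
  quadrance B (v + w) = quadrance B v + quadrance B w + 2%:R * bdot B v w.
Proof.
by move=> B_sym; rewrite /quadrance bdotDl !bdotDr (bdotC w v B_sym); ring.
Qed.

(** The law of cosines for the side [u], in squared form. The triangle
    condition is written with [u] first; the other two laws follow by permuting
    the summands. *)
Lemma cross_law (F : fieldType) (B : 'M[F]_3) (u v w : 'rV[F]_3) :
  B^T = B -> vector_triangle u v w ->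
  ~ null_vector B v -> ~ null_vector B w ->
  (quadrance B v + quadrance B w - quadrance B u) ^+ 2 =
  4%:R * quadrance B v * quadrance B w * (1 - spread B v w).
Proof.
rewrite /vector_triangle -addrA => B_sym /eqP; rewrite addr_eq0 => /eqP ->.
move=> /eqP Qv_neq0 /eqP Qw_neq0.
rewrite quadranceN quadranceD // /spread.
by field; rewrite Qv_neq0 Qw_neq0.
Qed.

Theorem theorem17 (F : fieldType) (B : 'M[F]_3) (v1 v2 v3 : 'rV[F]_3)
    (char_neq2 : 2%N \notin [pchar F])
    (B_inv : B \in unitmx) (B_sym : B^T = B)
    (triangle : vector_triangle v1 v2 v3)
    (v1_nonnull : ~ null_vector B v1)
    (v2_nonnull : ~ null_vector B v2)
    (v3_nonnull : ~ null_vector B v3) :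
  let Q1 := quadrance B v1 in
  let Q2 := quadrance B v2 in
  let Q3 := quadrance B v3 in
  let s1 := spread B v2 v3 in
  let s2 := spread B v1 v3 in
  let s3 := spread B v1 v2 in
  [/\ (Q2 + Q3 - Q1) ^+ 2 = 4%:R * Q2 * Q3 * (1 - s1),
      (Q1 + Q3 - Q2) ^+ 2 = 4%:R * Q1 * Q3 * (1 - s2)
    & (Q1 + Q2 - Q3) ^+ 2 = 4%:R * Q1 * Q2 * (1 - s3)].
Proof.
split.
- exact: cross_law.
- by apply: cross_law => //; rewrite /vector_triangle (addrC v2).
- by apply: cross_law => //; rewrite /vector_triangle -addrA addrC.
Qed.
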